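(* Let $p$ be an odd prime, let $w\in\{0,1\}^p$, and let $u\in\mathbb Z/p\mathbb Z\setminus\{0\}$. If $\mathrm{d_H}(w,\mathrm{rot}^u w)=2$, then $\delta(w)=2$; moreover, for this fixed $u$, there exist $s\in\mathbb Z/p\mathbb Z$ and a unique $t\in\{1,\dots,p-1\}$ such that $\mathrm{rot}^s w=w_{u,t}$. Conversely, for every $u\in\mathbb Z/p\mathbb Z\setminus\{0\}$ and $1\le t\le p-1$, the word $w_{u,t}$ satisfies $\mathrm{d_H}(w_{u,t},\mathrm{rot}^u w_{u,t})=2$. Moreover, for all such $u,t$, $$[w_{u,t}]=[w_{-u,t}],\qquad K_2(w_{u,t})=\begin{cases}\mathbb Z/p\mathbb Z\setminus\{0\},& t\in\{1,p-1\},\\ \{u,-u\},& 2\le t\le p-2.\end{cases}$$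
   Context: Words $w\in\{0,1\}^n$ are indexed by $\mathbb Z/n\mathbb Z$; $(\mathrm{rot}^k w)_i=w_{i-k}$; $[w]$ denotes the rotation orbit (necklace) of $w$; $\mathrm{d_H}$ is Hamming distance; $d_w(k)=\mathrm{d_H}(w,\mathrm{rot}^k w)$; $\delta(w)=\min_{1\le k\le n-1}d_w(k)$; $K_2(w)=\{k\in\{1,\dots,n-1\}:d_w(k)=2\}$, regarded as a subset of $\mathbb Z/n\mathbb Z\setminus\{0\}$. For $u\in\mathbb Z/p\mathbb Z\setminus\{0\}$ and $1\le t\le p-1$, let $I_{u,t}=\{0,u,\dots,(t-1)u\}\subseteq\mathbb Z/p\mathbb Z$ and let $w_{u,t}=\mathbf 1_{I_{u,t}}\in\{0,1\}^p$ be its indicator word. *)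

(* Defs.v *)
From mathcomp Require Import all_boot all_order all_algebra.

Set Implicit Arguments.
Unset Strict Implicit.
Unset Printing Implicit Defensive.

Import GRing.Theory.
Local Open Scope ring_scope.

(* The index set Z/nZ is 'Z_n, which is the intended ring only for n > 1. *)
Notation word n := {ffun 'Z_n -> bool}.

Definition rotw (n : nat) (k : 'Z_n) (w : word n) : word n :=
  [ffun i => w (i - k)].

Definition necklace (n : nat) (w : word n) : {set word n} :=
  [set rotw k w | k : 'Z_n].

Definition dH (n : nat) (v w : word n) : nat := #|[set i | v i != w i]|.

Definition drot (n : nat) (w : word n) (k : 'Z_n) : nat := dH w (rotw k w).

(* The default value n is harmless: for n > 1 the range is nonempty and every
   Hamming distance between words of length n is at most n. *)
Definition delta (n : nat) (w : word n) : nat :=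
  \big[minn/n]_(1 <= k < n) drot w k%:R.

Definition K2 (n : nat) (w : word n) : {set 'Z_n} :=
  [set k : 'Z_n | (k != 0) && (drot w k == 2%N)].

Definition prog (n : nat) (u : 'Z_n) (t : nat) : {set 'Z_n} :=
  [set u *+ j | j : 'I_t].

Definition prog_word (n : nat) (u : 'Z_n) (t : nat) : word n :=
  [ffun i => i \in prog u t].

(* Main.v *)
Require Import Defs.
From mathcomp Require Import all_boot all_order all_algebra.
From mathcomp Require Import zify.

(* Each rotation preserves the weight, so [dH w (rotw k w)] is twice the number
   of k-ascents of w, the positions i with w i = 1 and w (i - k) = 0.  Distance 2
   thus means a single u-ascent; read along the cycle 0, u, 2u, ... the word
   is then one block of ones, that is, a rotation of some [prog_word u t], and t
   is its weight.  If k = m u with m different from 1 and -1, a block of length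
   between 2 and p - 2 has at least two k-ascents. *)

Set Implicit Arguments.
Unset Strict Implicit.
Unset Printing Implicit Defensive.

Import GRing.Theory.
Local Open Scope ring_scope.

(** * Ascents, rotations and Hamming distance *)

Definition ascents (n : nat) (w : word n) (k : 'Z_n) : {set 'Z_n} :=
  [set i | w i && ~~ w (i - k)].

Lemma card_support_rotw (n : nat) (w : word n) (k : 'Z_n) :
  #|[set i | rotw k w i]| = #|[set i | w i]|.
Proof.
rewrite -[RHS](card_imset _ (addIr k)); apply: eq_card => i.
rewrite inE ffunE; apply/idP/imsetP => [wik|[j]].
  by exists (i - k); rewrite ?inE ?subrK.
by rewrite inE => wj ->; rewrite addrK.
Qed.

Lemma dH_rotw (n : nat) (w : word n) (k : 'Z_n) :
  dH w (rotw k w) = (#|ascents w k|).*2.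
Proof.
pose A := [set i | w i]; pose B := [set i | rotw k w i].
have -> : ascents w k = A :\: B by apply/setP=> i; rewrite !inE ffunE andbC.
(* Both differences complete [A :&: B] to sets of equal size, the supports of [w] and of its
   rotation. *)
have cAB : #|B :\: A| = #|A :\: B|.
  apply/eqP; rewrite -(eqn_add2l #|A :&: B|) cardsID setIC cardsID.
  by rewrite card_support_rotw.
rewrite -addnn -{2}cAB -cardsUI.
have -> : (A :\: B) :&: (B :\: A) = set0.
  by apply/setP=> i; rewrite !inE; case: (w i); rewrite ?andbF.
rewrite cards0 addn0; apply: eq_card => i; rewrite !inE.
by case: (w i); case: (rotw k w i).
Qed.

Lemma rotwD (n : nat) (w : word n) (j k : 'Z_n) :
  rotw j (rotw k w) = rotw (j + k) w.
Proof. by apply/ffunP=> i; rewrite !ffunE opprD addrA. Qed.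

Lemma rotw0 (n : nat) (w : word n) : rotw 0 w = w.
Proof. by apply/ffunP=> i; rewrite ffunE subr0. Qed.

(** Translation by [k] carries one set of disagreements onto the other. *)
Lemma dH_rotwN (n : nat) (w : word n) (k : 'Z_n) :
  dH w (rotw (- k) w) = dH w (rotw k w).
Proof.
rewrite /dH -(card_imset _ (addIr k)); apply: eq_card => i.
rewrite inE ffunE; apply/imsetP/idP => [[j]|h].
  by rewrite inE ffunE opprK eq_sym => h ->; rewrite addrK.
by exists (i - k); rewrite ?inE ?ffunE ?opprK subrK // eq_sym.
Qed.

Lemma necklace_rotw (n : nat) (w : word n) (k : 'Z_n) :
  necklace (rotw k w) = necklace w.
Proof.
apply/setP=> v; apply/imsetP/imsetP => -[j _ ->].
  by exists (j + k); rewrite ?rotwD.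
by exists (j - k); rewrite ?rotwD ?subrK.
Qed.

(** * Multiples of a nonzero residue modulo a prime *)

Lemma Zp_prime_unit (p : nat) (u : 'Z_p) :
  prime p -> u != 0 -> u \is a GRing.unit.
Proof.
move=> p_pr u0; have p1 := prime_gt1 p_pr.
rewrite -[u]natr_Zp unitZpE // prime_coprime // gtnNdvd //.
  by rewrite lt0n; apply: contraNneq u0 => u0; apply/eqP/val_inj.
by rewrite -[ltnRHS](Zp_cast p1) ltn_ord.
Qed.

Lemma eq_mulrn_Zp (p : nat) (u : 'Z_p) (j k : nat) :
  prime p -> u != 0 -> (u *+ j == u *+ k) = (j == k %[mod p]).
Proof.
move=> p_pr u0; have p1 := prime_gt1 p_pr.
rewrite -[u *+ j]mulr_natr -[u *+ k]mulr_natr.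
rewrite (inj_eq (mulrI (Zp_prime_unit p_pr u0))).
by rewrite -(inj_eq val_inj) /= !val_Zp_nat.
Qed.

(** With [eq_mulrn_Zp], this makes [j] a coordinate along the cycle 0, u, 2u, ..., so that claims on
    words become inequalities between naturals. *)
Lemma mulrn_Zp_surj (p : nat) (u i : 'Z_p) :
  prime p -> u != 0 -> exists2 j : nat, (j < p)%N & i = u *+ j.
Proof.
move=> p_pr u0; have p1 := prime_gt1 p_pr.
exists (val (u^-1 * i)); first by rewrite -[ltnRHS](Zp_cast p1) ltn_ord.
by rewrite -mulr_natr natr_Zp mulVKr // Zp_prime_unit.
Qed.

Lemma mulrn_Zp_char (p : nat) (u : 'Z_p) : (1 < p)%N -> u *+ p = 0.
Proof. by move=> p1; rewrite -mulr_natr pchar_Zp // mulr0. Qed.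

Lemma mulrn_Zp_pred (p : nat) (u : 'Z_p) : (1 < p)%N -> u *+ p.-1 = - u.
Proof.
move=> p1; apply/eqP; rewrite -addr_eq0 -mulrSr prednK ?(ltnW p1) //.
by rewrite mulrn_Zp_char.
Qed.

(** * Progression words in the coordinate [j] *)

Lemma prog_wordE (p : nat) (u : 'Z_p) (t j : nat) :
  prime p -> u != 0 -> (t <= p)%N ->
  prog_word u t (u *+ j) = (j %% p < t)%N.
Proof.
move=> p_pr u0 tp; rewrite ffunE; apply/imsetP/idP => [[k _ /eqP]|jt].
  by rewrite eq_mulrn_Zp // => /eqP ->; rewrite modn_small // (leq_trans _ tp).
by exists (Ordinal jt) => //=; apply/eqP; rewrite eq_mulrn_Zp // modn_mod.
Qed.

(** Adding [p] before subtracting [m] keeps the truncated subtraction of naturals exact. *)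
Lemma prog_wordBE (p : nat) (u : 'Z_p) (t j m : nat) :
  prime p -> u != 0 -> (t <= p)%N -> (m <= p)%N ->
  prog_word u t (u *+ j - u *+ m) = ((j + p - m) %% p < t)%N.
Proof.
move=> p_pr u0 tp mp; rewrite -(prog_wordE _ p_pr u0 tp); congr (prog_word u t _).
rewrite mulrnBr; last by rewrite (leq_trans mp) ?leq_addl.
by rewrite mulrnDr mulrn_Zp_char ?prime_gt1 // addr0.
Qed.

Lemma card_support_prog_word (p : nat) (u : 'Z_p) (t : nat) :
  prime p -> u != 0 -> (t <= p)%N -> #|[set i | prog_word u t i]| = t.
Proof.
move=> p_pr u0 tp.
have -> : [set i | prog_word u t i] = prog u t.
  by apply/setP=> i; rewrite inE ffunE.
rewrite card_imset ?card_ord // => j k /eqP.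
rewrite eq_mulrn_Zp // !modn_small ?(leq_trans (ltn_ord _) tp) // => /eqP.
exact: val_inj.
Qed.

(** The progression of step -u is the block of step u read backwards; translating by -(t-1)u brings
    the last element of the block to 0. *)
Lemma prog_word_rotwN (p : nat) (u : 'Z_p) (t : nat) :
  prime p -> u != 0 -> (1 <= t <= p)%N ->
  prog_word (- u) t = rotw (- (u *+ t.-1)) (prog_word u t).
Proof.
move=> p_pr u0 /andP[t1 tp]; have p1 := prime_gt1 p_pr.
apply/ffunP=> i; have Nu0 : - u != 0 by rewrite oppr_eq0.
have [j jp ->] := mulrn_Zp_surj i p_pr Nu0.
rewrite (prog_wordE _ p_pr Nu0 tp) ffunE opprK mulNrn addrC.
rewrite (prog_wordBE _ p_pr u0 tp (ltnW jp)) (modn_small jp).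
have [jt|tj] := ltnP j t.
  have -> : (t.-1 + p - j = (t.-1 - j) + p)%N by lia.
  by rewrite modnDr modn_small; lia.
by rewrite modn_small; lia.
Qed.

Lemma dH_rotw_prog_word (p : nat) (u : 'Z_p) (t : nat) :
  prime p -> u != 0 -> (1 <= t <= p.-1)%N ->
  dH (prog_word u t) (rotw u (prog_word u t)) = 2%N.
Proof.
move=> p_pr u0 /andP[t1 tp]; have p1 := prime_gt1 p_pr.
rewrite dH_rotw; suff -> : ascents (prog_word u t) u = [set 0] by rewrite cards1.
apply/setP=> i; rewrite !inE; have [j jp ->] := mulrn_Zp_surj i p_pr u0.
rewrite -[X in _ - X]mulr1n prog_wordBE ?prog_wordE //; try lia.
rewrite -[0](mulr0n u) eq_mulrn_Zp // mod0n modn_small //.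
(* The predecessor of 0 has coordinate p-1, outside the block because [t <= p.-1]; any other
   position of the block has its predecessor in the block. *)
case: j jp => [|j] jp; first by rewrite add0n modn_small; lia.
have -> : (j.+1 + p - 1 = j + p)%N by lia.
by rewrite modnDr modn_small; lia.
Qed.

(** * Classification of the words at distance two from a rotation *)

Lemma dH_rotw_eq2_prog_word (p : nat) (w : word p) (u : 'Z_p) :
  prime p -> u != 0 -> dH w (rotw u w) = 2%N ->
  exists s t, (1 <= t <= p.-1)%N /\ rotw s w = prog_word u t.
Proof.
move=> p_pr u0; have p1 := prime_gt1 p_pr.
rewrite dH_rotw -[2%N]/(1.*2)%N => /double_inj/eqP/cards1P[i0 Ei0].
(* This rotation moves the unique ascent to 0; the length [t] of the block will be the first zero of
   [v] along 0, u, 2u, ... *)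
pose v := rotw (- i0) w.
have vasc i : v i -> ~~ v (i - u) -> i = 0.
  rewrite !ffunE opprK addrAC => wi wiu.
  have : i + i0 \in ascents w u by rewrite inE wi.
  by rewrite Ei0 inE -{2}[i0]add0r (inj_eq (addIr i0)) => /eqP.
have : i0 \in ascents w u by rewrite Ei0 set11.
rewrite inE => /andP[wi0 wi0u].
have v0 : v 0 by rewrite ffunE opprK add0r.
have ex_t : exists j, ~~ v (u *+ j).
  (* Position (p-1)u is -u, where [v] vanishes because 0 is an ascent. *)
  exists p.-1; rewrite ffunE opprK.
  by rewrite mulrn_Zp_pred // addrC.
have [t vt tmin] := ex_minnP ex_t.
have t1 : (0 < t)%N by case: t vt {tmin} => //; rewrite mulr0n v0.
have tp : (t <= p.-1)%N.
  apply: tmin; rewrite ffunE opprK.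
  by rewrite mulrn_Zp_pred // addrC.
(* A return from zero to one after [t] would be an ascent away from 0, so the zeros persist until
   the cycle closes. *)
have vge d : (t + d < p)%N -> ~~ v (u *+ (t + d)).
  elim: d => [|d IHd]; first by rewrite addn0.
  rewrite addnS => dp; apply/negP => /vasc h.
  have /eqP := h (ltac:(by rewrite mulrSr addrK IHd // ltnW)).
  by rewrite -[0](mulr0n u) eq_mulrn_Zp // mod0n modn_small.
exists (- i0), t; split; first exact/andP.
apply/ffunP=> i; have [j jp ->] := mulrn_Zp_surj i p_pr u0.
rewrite prog_wordE //; last by lia.
rewrite modn_small //; have [jt|tj] := ltnP j t.
  by apply: contraLR jt => /tmin; rewrite -leqNgt.
by apply: negbTE; rewrite -(subnKC tj); apply: vge; rewrite subnKC.
Qed.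

(** The distance is even, so only 0 must be excluded. If rotation by [k] fixed [w], so would
    rotation by every multiple of [k], in particular by [u]. *)
Lemma dH_rotw_ge2 (p : nat) (w : word p) (u k : 'Z_p) :
  prime p -> k != 0 -> dH w (rotw u w) != 0%N ->
  (2 <= dH w (rotw k w))%N.
Proof.
move=> p_pr k0 du; have [dk|] := posnP (dH w (rotw k w)); last first.
  by rewrite dH_rotw; case: #|_|.
have wk : rotw k w = w.
  apply/ffunP=> i; apply/eqP; move/eqP: dk; rewrite cards_eq0 => /eqP/setP/(_ i).
  by rewrite !inE eq_sym => /negbFE.
have [j _ uE] := mulrn_Zp_surj u p_pr k0.
case/eqP: du; rewrite uE; elim: j {uE} => [|j IHj].
  by rewrite mulr0n rotw0; apply/eqP; rewrite cards_eq0; apply/eqP/setP=> i;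
    rewrite !inE eqxx.
by rewrite mulrSr -rotwD wk.
Qed.

Lemma delta_eq2 (p : nat) (w : word p) (u : 'Z_p) :
  prime p -> u != 0 -> dH w (rotw u w) = 2%N -> delta w = 2%N.
Proof.
move=> p_pr u0 du; have p1 := prime_gt1 p_pr.
have vu_p : (val u < p)%N by rewrite -[ltnRHS](Zp_cast p1) ltn_ord.
apply/eqP; rewrite eqn_leq; apply/andP; split.
  rewrite -[leqRHS]du -[u in leqRHS]natr_Zp.
  have : val u \in index_iota 1 p.
    rewrite mem_index_iota vu_p andbT lt0n.
    by apply: contraNneq u0 => vu0; apply/eqP/val_inj.
  (* An iterated minimum is at most each of its terms, here the one of index [val u]. *)
  rewrite /delta; elim: (index_iota 1 p) => // k s IHs.
  rewrite inE big_cons => /predU1P[<-|/IHs le_s]; first exact: geq_minl.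
  exact: leq_trans (geq_minr _ _) le_s.
(* The default value [p] of the minimum is itself at least 2. *)
rewrite /delta big_seq; elim/big_ind: _ => // [m n m2 n2|k].
  by rewrite leq_min m2.
rewrite mem_index_iota => /andP[k1 kp]; apply: (@dH_rotw_ge2 _ _ u) => //.
  by rewrite -(inj_eq val_inj) /= val_Zp_nat // modn_small // -lt0n.
by rewrite du.
Qed.

(** * Rotations at distance two from a progression word *)

Lemma card_ascents_prog_word1 (p : nat) (u k : 'Z_p) :
  k != 0 -> #|ascents (prog_word u 1) k| = 1%N.
Proof.
move=> k0; have prog1 : prog u 1 = [set 0].
  apply/setP=> i; rewrite inE; apply/imsetP/eqP => [[j _ ->]|->].
    by rewrite ord1.
  by exists ord0.
suff -> : ascents (prog_word u 1) k = [set 0] by rewrite cards1.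
apply/setP=> i; rewrite !inE !ffunE prog1 !inE; have [->|//] := eqVneq i 0.
by rewrite sub0r oppr_eq0 k0.
Qed.

(** The word has a single zero, at (p-1)u, and a [k]-ascent can only sit [k] after it. *)
Lemma card_ascents_prog_word_pred (p : nat) (u k : 'Z_p) :
  prime p -> u != 0 -> k != 0 -> #|ascents (prog_word u p.-1) k| = 1%N.
Proof.
move=> p_pr u0 k0; have p1 := prime_gt1 p_pr.
have progE i : prog_word u p.-1 i = (i != u *+ p.-1).
  have [j jp ->] := mulrn_Zp_surj i p_pr u0.
  rewrite prog_wordE ?leq_pred // eq_mulrn_Zp // !modn_small //; lia.
suff -> : ascents (prog_word u p.-1) k = [set u *+ p.-1 + k].
  by rewrite cards1.
apply/setP=> i; rewrite !inE !progE negbK subr_eq.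
have [->|] := eqVneq i (_ + k); last by rewrite andbF.
by rewrite addrC -subr_eq0 addrK k0.
Qed.

(** Write k = mu with 2 <= m <= p-2. The coordinates [a] and [a.+1] lie in the block but not in its
    shift by m: without wrapping, they are 0 and 1, below both m and t; with wrapping, they follow
    the wrapped end of the shift, and [a.+1] is below m since t <= p-2 and below t since m <=
    p-2. *)
Lemma two_ascents_prog_word (p : nat) (u k : 'Z_p) (t : nat) :
  prime p -> u != 0 -> k != 0 -> k != u -> k != - u -> (2 <= t <= p - 2)%N ->
  (2 <= #|ascents (prog_word u t) k|)%N.
Proof.
move=> p_pr u0 k0 ku kNu /andP[t2 tp]; have p1 := prime_gt1 p_pr.
have [m mp kE] := mulrn_Zp_surj k p_pr u0.
have m0 : m != 0%N by apply: contraNneq k0 => m0; rewrite kE m0.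
have m1 : m != 1%N by apply: contraNneq ku => m1; rewrite kE m1.
have mp1 : m != p.-1.
  by apply: contraNneq kNu => mE; rewrite kE mE mulrn_Zp_pred.
(* The block shifted by m wraps around 0 exactly when m + t > p. *)
pose a := (if m + t <= p then 0 else m + t - p)%N.
have asc j : (a <= j <= a.+1)%N -> u *+ j \in ascents (prog_word u t) k.
  move=> aj; rewrite inE kE prog_wordBE ?prog_wordE //; try lia.
  have jt : (j < t)%N by rewrite /a in aj; case: ifP aj; lia.
  have jp : (j < p)%N by lia.
  rewrite modn_small // jt -leqNgt.
  (* The case [m <= j] is void, since [a.+1] is less than [m]. *)
  have [mj|jm] := leqP m j.
    have -> : (j + p - m = (j - m) + p)%N by lia.
    rewrite modnDr modn_small; last by lia.
    by rewrite /a in aj; case: ifP aj; lia.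
  rewrite modn_small; last by lia.
  by rewrite /a in aj; case: ifP aj; lia.
have neq : u *+ a != u *+ a.+1.
  by rewrite eq_mulrn_Zp // !modn_small //; rewrite /a; case: ifP; lia.
have <- : #|[set u *+ a; u *+ a.+1]| = 2%N by rewrite cards2 neq.
apply: subset_leq_card; apply/subsetP=> i; rewrite !inE.
by case/orP=> /eqP->; have := asc a; have := asc a.+1; rewrite !inE;
  move=> h1 h2; [apply: h2 | apply: h1]; lia.
Qed.

Theorem proposition6p11 (p : nat) (p_prime : prime p) (p_odd : odd p) :
  (forall (w : word p) (u : 'Z_p), u != 0 -> dH w (rotw u w) = 2%N ->
     delta w = 2%N /\
     exists! t : nat, (1 <= t <= p.-1)%N /\
       exists s : 'Z_p, rotw s w = prog_word u t) /\
  (forall (u : 'Z_p) (t : nat), u != 0 -> (1 <= t <= p.-1)%N ->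
     [/\ dH (prog_word u t) (rotw u (prog_word u t)) = 2%N,
         necklace (prog_word u t) = necklace (prog_word (- u) t),
         (t = 1%N \/ t = p.-1 -> K2 (prog_word u t) = [set k : 'Z_p | k != 0]) &
         ((2 <= t <= p - 2)%N -> K2 (prog_word u t) = [set u; - u])]).
Proof.
have p1 := prime_gt1 p_prime.
split=> [w u u0 du|u t u0 /andP[t1 tp]].
  split; first exact: delta_eq2 du.
  have [s [t [t_bnd wE]]] := dH_rotw_eq2_prog_word p_prime u0 du.
  exists t; split=> [|t' [/andP[_ t'p] [s' wE']]]; first by split=> //; exists s.
  case/andP: t_bnd => _ tp.
  (* Uniqueness: [t] and [t'] both equal the weight of [w], which rotations preserve. *)
  rewrite -(card_support_prog_word (u := u) (t := t) p_prime u0); last by lia.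
  rewrite -(card_support_prog_word (u := u) (t := t') p_prime u0); last by lia.
  by rewrite -wE -wE' !card_support_rotw.
have du := dH_rotw_prog_word p_prime u0 (introT andP (conj t1 tp)).
split=> // [|t_extr|t_mid].
- by rewrite prog_word_rotwN ?necklace_rotw // t1; lia.
- apply/setP=> k; rewrite !inE; have [//|k0] := eqVneq k 0.
  rewrite /drot dH_rotw; case: t_extr => ->.
    by rewrite card_ascents_prog_word1.
  by rewrite card_ascents_prog_word_pred.
apply/setP=> k; rewrite !inE /drot.
have [->|ku] := eqVneq k u; first by rewrite du u0.
have [->|kNu] := eqVneq k (- u); first by rewrite dH_rotwN du oppr_eq0 u0.
have [//|k0] := eqVneq k 0.
(* Two ascents force distance at least 4. *)
have := two_ascents_prog_word p_prime u0 k0 ku kNu t_mid.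
by rewrite dH_rotw; case: #|_| => [|[|]].
Qed.
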